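(* Let $\{\mathbb{P}_\mu:\mu\in\bar M\}$, $\bar M\subset\mathbb{R}^k$, be an exponential family in its mean-value parametrization with sufficient statistic $\phi$, such that for all $n$ and all $x_1,\dots,x_n\in\mathcal{X}$ the maximum likelihood estimator over $\bar M$ satisfies $$\hat\mu^{\mathrm{MLE}}_n=\hat\mu^{\mathrm{MLE}}(x^n)=\frac1n\sum_{i=1}^n\phi(x_i)\in\bar M .$$ Let $M\subseteq\bar M$ be such that there exist constants $\sigma>0$ and $\delta>0$ with $$\mathbb{E}_{X\sim\mathbb{P}_\mu}\left[e^{\eta^T(\phi(X)-\mu)}\right]\le e^{\sigma\eta^T\eta/2}\quad\text{for all }\mu\in M\text{ and all }\eta\in\mathbb{R}^k\text{ with }\|\eta\|^2\le\delta .$$ Then there exists a constant $C>0$ such that $$\sup_{\mu\in M}\mathbb{E}_{X^\infty\sim\mathbb{P}_\mu}\left[\sup_{n\in\mathbb{N}}\frac{\|\mu-\hat\mu^{\mathrm{MLE}}_n\|^2}{f(n)}\right]\le C,$$ where $f(n)=n^{-1}\log\log n$ for $n\ge3$ and $f(n)=1$ for $n=1,2$.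
   Context: Exponential family: densities $p_\theta(x)=r(x)e^{\theta^T\phi(x)-\psi(\theta)}$, $x\in\mathcal{X}$, $\theta\in\bar\Theta\subset\mathbb{R}^k$, with sufficient statistic $\phi:\mathcal{X}\to\mathbb{R}^k$. The mean-value parameter is $\mu(\theta)=\mathbb{E}_{X\sim\mathbb{P}_\theta}[\phi(X)]$; the map $\theta\mapsto\mu(\theta)$ is invertible, and the family is reparametrized by $\mu\in\bar M$, so $\mathbb{E}_{X\sim\mathbb{P}_\mu}[\phi(X)]=\mu$. If necessary, the family is extended by distributions on the boundary of the mean-value parameter space (e.g. for the Bernoulli family $\bar M=[0,1]$, including the degenerate distributions) so that the MLE lies in $\bar M$ and is unique. $X^\infty\sim\mathbb{P}_\mu$ means that $X_1,X_2,\dots$ are i.i.d. from $\mathbb{P}_\mu$. $\|\cdot\|$ is the Euclidean norm. The MLE is taken relative to the full set $\bar M$, not the possibly smaller set $M$. *)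

(* Defs.v *)
From HB Require Import structures.
From mathcomp Require Import all_boot all_order all_algebra.
From mathcomp Require Import all_classical all_reals all_analysis.
From mathcomp Require Import measurable_realfun.
Set Implicit Arguments.
Unset Strict Implicit.
Unset Printing Implicit Defensive.
Import Order.TTheory GRing.Theory Num.Theory.
Import numFieldNormedType.Exports.
Local Open Scope classical_set_scope.
Local Open Scope ring_scope.

Section Euclidean.
Context {R : realType} {k : nat}.
Implicit Types u v : 'rV[R]_k.

Definition dotv u v : R := \sum_(i < k) u 0 i * v 0 i.

(* The norm [`|u|] of the library is the sup norm, hence this definition. *)
Definition enorm u : R := Num.sqrt (dotv u u).

End Euclidean.

Section ExponentialFamily.
Context {d : measure_display} {X : measurableType d} {R : realType} {k : nat}.
Implicit Types (nu : {measure set X -> \bar R}) (P : probability X R).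
Implicit Types (phi : X -> 'rV[R]_k).

(* Densities may take the value +oo, so that they also make sense for members
   of the family that are singular to [nu] (e.g. degenerate normal laws on the
   boundary): the equation forces [f = +oo] to be [nu]-null, and the singular
   part of [P] is concentrated there (Lebesgue decomposition). If [f] is finite
   everywhere, the last term vanishes and this is dP = f dnu. *)
Definition has_density nu (f : X -> \bar R) P : Prop :=
  [/\ measurable_fun setT f,
      (forall x, 0 <= f x)%E &
      forall A, measurable A ->
        P A = ((\int[nu]_(x in A) f x) + P (A `&` [set x | f x = +oo%E]))%E].

Definition integrable_stat phi P : Prop :=
  forall i, P.-integrable setT (EFin \o (fun x => phi x 0 i)).

Definition mean_stat phi P : 'rV[R]_k :=
  \row_i fine (\int[P]_x (phi x 0 i)%:E)%E.

Definition natural_density (r : X -> R) phi (psi : 'rV[R]_k -> R)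
    (theta : 'rV[R]_k) (x : X) : R :=
  r x * expR (dotv theta (phi x) - psi theta).

Record natural_exponential_family nu (r : X -> R) phi (psi : 'rV[R]_k -> R)
    (Theta : set 'rV[R]_k) (Q : 'rV[R]_k -> probability X R) : Prop := {
  nef_carrier_measurable : measurable_fun setT r ;
  nef_carrier_ge0 : forall x, 0 <= r x ;
  nef_stat_measurable : forall i, measurable_fun setT (fun x => phi x 0 i) ;
  nef_density : forall theta, Theta theta ->
    has_density nu (EFin \o natural_density r phi psi theta) (Q theta) ;
  nef_integrable : forall theta, Theta theta -> integrable_stat phi (Q theta) ;
  nef_mean_inj : forall theta theta', Theta theta -> Theta theta' ->
    mean_stat phi (Q theta) = mean_stat phi (Q theta') -> theta = theta'
}.

(* [Mbar] consists of the means of the natural family and possibly of further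
   points of the boundary of that set of means. [p mu] is the version of the
   density of [P mu] used in the likelihood. *)
Record mean_value_exponential_family nu (r : X -> R) phi (psi : 'rV[R]_k -> R)
    (Theta Mbar : set 'rV[R]_k) (Q P : 'rV[R]_k -> probability X R)
    (p : 'rV[R]_k -> X -> \bar R) : Prop := {
  mvef_natural : natural_exponential_family nu r phi psi Theta Q ;
  mvef_reparam : forall theta, Theta theta ->
    let mu := mean_stat phi (Q theta) in
    [/\ Mbar mu,
        (forall A, measurable A -> P mu A = Q theta A) &
        p mu = EFin \o natural_density r phi psi theta] ;
  mvef_boundary :
    let M0 := [set mean_stat phi (Q theta) | theta in Theta] in
    Mbar `\` M0 `<=` closure M0 `\` interior M0 ;
  mvef_density : forall mu, Mbar mu -> has_density nu (p mu) (P mu) ;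
  mvef_integrable : forall mu, Mbar mu -> integrable_stat phi (P mu) ;
  mvef_mean : forall mu, Mbar mu -> mean_stat phi (P mu) = mu
}.

Definition likelihood (p : 'rV[R]_k -> X -> \bar R) n (x : 'I_n -> X)
    (mu : 'rV[R]_k) : \bar R :=
  (\prod_(i < n) p mu (x i))%E.

Definition is_unique_mle (Mbar : set 'rV[R]_k) (p : 'rV[R]_k -> X -> \bar R)
    n (x : 'I_n -> X) (m : 'rV[R]_k) : Prop :=
  Mbar m /\ forall mu, Mbar mu -> mu != m ->
    (likelihood p x mu < likelihood p x m)%E.

End ExponentialFamily.

Definition iid {d d' : measure_display} {W : measurableType d'}
    {X : measurableType d} {R : realType} (PW : probability W R)
    (xi : nat -> W -> X) (P : probability X R) : Prop :=
  [/\ forall i, measurable_fun setT (xi i),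
      forall i A, measurable A -> PW (xi i @^-1` A) = P A &
      forall (J : seq nat) (A : nat -> set X), uniq J ->
        (forall i, measurable (A i)) ->
        PW (\bigcap_(i in [set` J]) (xi i @^-1` A i)) =
        (\prod_(i <- J) PW (xi i @^-1` A i))%E].

Definition lil_rate {R : realType} (n : nat) : R :=
  if (3 <= n)%N then n%:R^-1 * ln (ln n%:R) else 1.

(* The sample X_1, X_2, ... is [xi 0, xi 1, ...], and [mle n] is applied to its
   first [n] terms. *)
Definition sup_scaled_sq_error {d d' : measure_display} {W : measurableType d'}
    {X : measurableType d} {R : realType} {k : nat}
    (mle : forall n, ('I_n -> X) -> 'rV[R]_k) (xi : nat -> W -> X)
    (mu : 'rV[R]_k) (w : W) : \bar R :=
  ereal_sup [set ((enorm (mu - mle n (fun i : 'I_n => xi i w))) ^+ 2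
                   / lil_rate n)%:E | n in [set n | (0 < n)%N]].

(* The value of E_{X^oo ~ P} [sup_n ...] only depends on [P]; the set collects
   it over all realizations of an i.i.d. sequence with law [P mu], mu in M. *)
Definition sup_risks {d : measure_display} {X : measurableType d}
    {R : realType} {k : nat} (P : 'rV[R]_k -> probability X R)
    (mle : forall n, ('I_n -> X) -> 'rV[R]_k) (M : set 'rV[R]_k)
    : set (\bar R) :=
  [set e | exists2 mu, M mu &
    exists (d' : measure_display) (W : measurableType d')
           (PW : probability W R) (xi : nat -> W -> X),
      iid PW xi (P mu) /\
      e = (\int[PW]_w sup_scaled_sq_error mle xi mu w)%E].

(* Main.v *)
(* Fix a coordinate i and cut the times into blocks 2^m <= n < 2^(m+1). With
   lam^2 = delta ln(m+2) / 2^m, a vector of norm at most sqrt delta, the products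
   s_n of the factors exp((+-lam (phi_i - mu_i) - sigma lam^2/2) / 2) satisfy
   E[s_(n+1)^2 | past] <= s_n^2, and then m_n + s_n^2 / m_n, where m_n is the
   running maximum of s, is a supermartingale, so E m_n <= 2. On the block, the
   centred sum S_n satisfies lam |S_n| <= 2 ln A + n sigma lam^2/2, where A is the
   sum of the two running maxima. Hence S_n^2 / (n ln(m+2)) is at most a constant
   plus a multiple of (ln A / ln(m+2))^2, which in turn is at most a constant plus
   a multiple of A / (m+2)^2; the latter has a summable expectation. *)
Require Import Defs.
From HB Require Import structures.
From mathcomp Require Import all_boot all_order all_algebra.
From mathcomp Require Import all_classical all_reals all_analysis.
From mathcomp Require Import measurable_realfun.
From mathcomp Require Import ring lra.
Import Order.TTheory GRing.Theory Num.Theory.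
Import numFieldNormedType.Exports.
Local Open Scope classical_set_scope.
Local Open Scope ring_scope.
Set Implicit Arguments.
Unset Strict Implicit.

(** * Independence of an observation from the preceding ones *)

Definition past_cylinders (d d' : measure_display) (W : measurableType d')
    (X : measurableType d) (xi : nat -> W -> X) (n : nat) : set (set W) :=
  [set B | exists2 A : nat -> set X, (forall i, measurable (A i)) &
    B = \bigcap_(i in `I_n) xi i @^-1` A i].

(** The carrier is still [W], with a smaller sigma-algebra; being adapted is expressed by retyping
    the domain of a function as [past xi n]. Indices start at 0, so [xi n] is the first observation
    outside this past. *)
Definition past (d d' : measure_display) (W : measurableType d')
    (X : measurableType d) (xi : nat -> W -> X) (n : nat) :=
  g_sigma_algebraType (past_cylinders xi n).

Lemma past_sub_measurable (d d' : measure_display) (W : measurableType d')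
    (X : measurableType d) (xi : nat -> W -> X) (n : nat) :
  (forall i, measurable_fun setT (xi i)) ->
  <<s past_cylinders xi n >> `<=` @measurable _ W.
Proof.
move=> mxi; apply: smallest_sub; first exact: sigma_algebra_measurable.
move=> B [A mA ->]; apply: bigcap_measurableType => // i _.
by rewrite -[_ @^-1` _]setTI; exact: mxi.
Qed.

(** Pi-lambda argument: the cylinders are stable under intersection and satisfy the product formula
    by [iid], while the events [B] that satisfy it are stable under complements and countable
    disjoint unions. *)
Lemma past_indep (d d' : measure_display) (W : measurableType d')
    (X : measurableType d) (R : realType) (PW : probability W R)
    (xi : nat -> W -> X) (P : probability X R) (n : nat) (A : set X) (B : set W) :
  iid PW xi P -> measurable A -> <<s past_cylinders xi n >> B ->
  PW (B `&` xi n @^-1` A) = (PW B * P A)%E.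
Proof.
move=> [mxi lxi ixi] mA; move: B.
have sub := past_sub_measurable (n := n) mxi.
have mxA : measurable (xi n @^-1` A) by rewrite -[_ @^-1` _]setTI; exact: mxi.
have fPA : P A \is a fin_num by exact: fin_num_measure.
have indC (S : set W) : measurable S ->
    PW (S `&` xi n @^-1` A) = (PW S * P A)%E ->
    PW (~` S `&` xi n @^-1` A) = (PW (~` S) * P A)%E.
  move=> mS PS.
  transitivity (PW (xi n @^-1` A) - PW (S `&` xi n @^-1` A))%E.
    rewrite setIC -setDE measureD// 1?setIC//.
    by rewrite ltey_eq fin_num_measure.
  rewrite PS lxi// probability_setC// muleBl//.
  by rewrite mul1e.
have indU (F : (set W)^nat) : (forall i, measurable (F i)) ->
    trivIset setT F ->
    (forall i, PW (F i `&` xi n @^-1` A) = (PW (F i) * P A)%E) ->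
    PW (\bigcup_k F k `&` xi n @^-1` A) = (PW (\bigcup_k F k) * P A)%E.
  move=> mF tF PF; rewrite setI_bigcupl !measure_bigcup//; last 2 first.
    by move=> i _; exact: measurableI.
    exact: trivIset_setIr.
  rewrite -(fineK fPA) muleC -nneseriesZl//.
  apply: eq_eseriesr => i _; rewrite fineK// muleC.
  exact: PF.
apply: (@dynkin_induction _ (past xi n) _
  (fun B => PW (B `&` xi n @^-1` A) = (PW B * P A)%E)) => //.
- move=> _ _ [A1 mA1 ->] [A2 mA2 ->].
  exists (fun i => A1 i `&` A2 i); first by move=> i; exact: measurableI.
  by rewrite -bigcapI.
- by rewrite setTI lxi// probability_setT mul1e.
- move=> _ [A1 mA1 ->].
  (* Putting [A] at index n turns the intersection into a cylinder over n + 1 observations; the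
     product formula for [iota 0 n.+1] then splits off its last factor. *)
  pose A2 i := if (i < n)%N then A1 i else A.
  have mA2 i : measurable (A2 i) by rewrite /A2; case: ifP.
  have A2n : A2 n = A by rewrite /A2 ltnn.
  have A2i i : (i < n)%N -> A2 i = A1 i by rewrite /A2 => ->.
  have -> : \bigcap_(i in `I_n) xi i @^-1` A1 i =
      \bigcap_(i in [set` iota 0 n]) xi i @^-1` A2 i.
    by rewrite Iiota; apply: eq_bigcapr => i /= /A2i ->.
  rewrite (ixi _ _ (iota_uniq _ _) mA2) -A2n -(lxi n)//.
  have := ixi (iota 0 n.+1) A2 (iota_uniq _ _) mA2.
  rewrite -[n.+1]addn1 iotaD add0n big_cat/= big_seq1 => <-; congr (PW _).
  apply/seteqP; split => w /=.
    by move=> [h1 h2] i /=; rewrite mem_cat inE => /orP[/h1|/eqP->].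
  move=> h; split; first by move=> i /= lin; apply: h; rewrite /= mem_cat lin.
  by apply: h; rewrite /= mem_cat inE eqxx orbT.
- by move=> S mS; apply: indC; exact: sub.
- by move=> F mF tF PF; apply: indU => // i; apply: sub; exact: mF.
Qed.

Lemma past_measurable_obs (d d' : measure_display) (W : measurableType d')
    (X : measurableType d) (xi : nat -> W -> X) (n i : nat) :
  (i < n)%N -> measurable_fun setT (xi i : past xi n -> X).
Proof.
move=> lin _ A mA; rewrite setTI; apply: sub_sigma_algebra.
exists (fun j => if j == i then A else setT); first by move=> j; case: ifP.
apply/seteqP; split => w /=.
  by move=> wA j _; rewrite /preimage/=; case: eqP => // ->.
by move=> /(_ i lin); rewrite /preimage/= eqxx.
Qed.


Lemma past_measurable_fun (d d' d'' : measure_display) (W : measurableType d')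
    (X : measurableType d) (Y : measurableType d'') (xi : nat -> W -> X) (n : nat)
    (F : W -> Y) :
  (forall i, measurable_fun setT (xi i)) ->
  measurable_fun setT (F : past xi n -> Y) -> measurable_fun setT F.
Proof.
move=> mxi mF _ A mA; rewrite setTI; apply: (past_sub_measurable (n := n) mxi).
by have := mF measurableT A mA; rewrite setTI.
Qed.

(** This replaces conditioning on the past: by independence the joint law of [F] and [xi n] is a
    product measure, and Tonelli integrates [g] out first. *)
Lemma past_mul_le (d d' : measure_display) (W : measurableType d')
    (X : measurableType d) (R : realType) (PW : probability W R)
    (xi : nat -> W -> X) (P : probability X R) (n : nat)
    (F : W -> R) (g : X -> R) :
  iid PW xi P ->
  measurable_fun setT (F : past xi n -> R) -> (forall w, 0 <= F w) ->
  measurable_fun setT g -> (forall x, 0 <= g x) ->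
  (\int[P]_x (g x)%:E <= 1)%E ->
  (\int[PW]_w (F w * g (xi n w))%:E <= \int[PW]_w (F w)%:E)%E.
Proof.
move=> hiid mF F0 mg g0 g1.
have [mxi lxi _] := hiid.
have mFW : measurable_fun setT F by exact: past_measurable_fun mF.
have mT : measurable_fun setT (fun w => (F w, xi n w)).
  exact: measurable_fun_pair.
pose Fm : {mfun W >-> R} := HB.pack F (isMeasurableFun.Build _ _ _ _ F mFW).
pose Tm : {mfun W >-> (R * X)%type} := HB.pack (fun w => (F w, xi n w))
  (isMeasurableFun.Build _ _ _ _ (fun w => (F w, xi n w)) mT).
(* The absolute value makes the integrand nonnegative on the whole product space; it changes nothing
   along [F], which is nonnegative. *)
pose h (z : R * X) : \bar R := (`|z.1| * g z.2)%:E.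
have mh : measurable_fun setT h.
  apply/measurable_EFinP; apply: measurable_funM.
    by apply: measurableT_comp => //; exact: normr_measurable.
  by apply: measurableT_comp.
have h0 z : (0 <= h z)%E by rewrite lee_fin mulr_ge0.
have -> : (\int[PW]_w (F w * g (xi n w))%:E =
    \int[distribution PW Tm]_z h z)%E.
  rewrite ge0_integral_distribution//; apply: eq_integral => w _.
  by rewrite /h /= ger0_norm.
have -> : (\int[distribution PW Tm]_z h z =
    \int[(distribution PW Fm \x P)]_z h z)%E.
  apply: eq_measure_integral => A mA _; symmetry.
  apply: product_measure_unique => // B1 B2 mB1 mB2.
  apply: (past_indep (n := n) hiid mB2).
  by have := mF measurableT B1 mB1; rewrite setTI.
rewrite fubini_tonelli1//.
have -> : (\int[PW]_w (F w)%:E = \int[distribution PW Fm]_x `|x|%:E)%E.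
  rewrite ge0_integral_distribution//; last first.
    by apply/measurable_EFinP; exact: normr_measurable.
  by apply: eq_integral => w _ /=; rewrite ger0_norm.
apply: ge0_le_integral => //.
- by move=> x _; exact: integral_ge0.
- exact: measurable_fun_fubini_tonelli_F.
- by apply/measurable_EFinP; exact: normr_measurable.
- move=> x _; rewrite /fubini_F /h /=.
  under eq_integral do rewrite EFinM.
  rewrite ge0_integralZl//; last 2 first.
    exact/measurable_EFinP.
    by move=> y _; rewrite lee_fin.
  by rewrite -[leRHS]mule1 lee_wpmul2l.
Qed.

(** * A maximal inequality for products of independent factors *)

Fixpoint run_max (R : realType) (s : nat -> R) (n : nat) : R :=
  if n is n'.+1 then Num.max (run_max s n') (s n) else s 0%N.

Lemma run_max_ge (R : realType) (s : nat -> R) (n i : nat) :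
  (i <= n)%N -> s i <= run_max s n.
Proof.
elim: n => [|n IH]; first by rewrite leqn0 => /eqP ->.
by rewrite leq_eqVlt /= le_max => /orP[/eqP->|/IH ->//]; rewrite lexx orbT.
Qed.

Lemma measurable_run_max (d : measure_display) (T : measurableType d)
    (R : realType) (s : nat -> T -> R) (n : nat) :
  (forall i, (i <= n)%N -> measurable_fun setT (s i)) ->
  measurable_fun setT (fun t => run_max (s ^~ t) n).
Proof.
elim: n => [|n IH] ms /=; first exact: ms.
by apply: measurable_maxr; [apply: IH => i /leqW; exact: ms|exact: ms].
Qed.

(** The expected running maximum of a nonnegative supermartingale s^2 has in general no bound
    uniform in n, but that of its square root s has one. This is why the second moment of [h] is
    controlled, and why square roots of the exponential factors are used below. *)
Lemma expectation_run_max_le (d d' : measure_display) (W : measurableType d')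
    (X : measurableType d) (R : realType) (PW : probability W R)
    (xi : nat -> W -> X) (P : probability X R) (h : X -> R) (n : nat) :
  iid PW xi P -> measurable_fun setT h -> (forall x, 0 <= h x) ->
  (\int[P]_x (h x ^+ 2)%:E <= 1)%E ->
  (\int[PW]_w (run_max (fun j => \prod_(i < j) h (xi i w)) n)%:E <= 2%:E)%E.
Proof.
move=> hiid mh h0 h1.
have [mxi _ _] := hiid.
pose s j w := \prod_(i < j) h (xi i w).
have s0 j w : 0 <= s j w by apply: prodr_ge0.
pose m j w := run_max (s ^~ w) j.
have m1 j w : 1 <= m j w.
  by apply: le_trans (run_max_ge (s ^~ w) (leq0n j)); rewrite /s big_ord0.
have m0 j w : 0 < m j w by exact: lt_le_trans ltr01 (m1 j w).
pose V j w := s j w ^+ 2 / m j w.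
have V0 j w : 0 <= V j w by rewrite /V divr_ge0 ?sqr_ge0// ltW.
have ms_past j i : (i <= j)%N -> measurable_fun setT (s i : past xi j -> R).
  move=> ij.
  have -> : s i = fun w => \prod_(l <- iota 0 i) h (xi l w).
    apply/funext => w.
    by rewrite /s -[in RHS](subn0 i) -/(index_iota 0 i) big_mkord.
  apply: (@measurable_prod _ (past xi j) R setT _ (iota 0 i)
    (fun l w => h (xi l w))) => l; rewrite mem_iota/= add0n => li.
  apply: measurableT_comp => //; apply: past_measurable_obs.
  exact: leq_trans ij.
have mm_past j : measurable_fun setT (m j : past xi j -> R).
  by apply: measurable_run_max => i ij; exact: ms_past.
have mV_past j : measurable_fun setT (V j : past xi j -> R).
  apply: measurable_funM; first by apply: measurable_funX; exact: ms_past.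
  (* On positive reals the inverse is the power with exponent -1, which is measurable. *)
  have -> : (fun w : past xi j => (m j w)^-1) = (fun w => m j w `^ (-1)).
    by apply/funext => w; rewrite powR_inv1// ltW.
  exact: (measurableT_comp (@measurable_powR R (- 1)) (mm_past j)).
have mm j : measurable_fun setT (m j) by exact: past_measurable_fun (mm_past j).
have mV j : measurable_fun setT (V j) by exact: past_measurable_fun (mV_past j).
have mmE j : measurable_fun setT (EFin \o m j) by exact/measurable_EFinP.
have ED (f g : W -> R) : measurable_fun setT f -> measurable_fun setT g ->
    (forall w, 0 <= f w) -> (forall w, 0 <= g w) ->
    (\int[PW]_w (f w + g w)%:E =
     \int[PW]_w (f w)%:E + \int[PW]_w (g w)%:E)%E.
  move=> mf mg f0 g0; under eq_integral do rewrite EFinD.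
  rewrite ge0_integralD//; try by move=> w _; rewrite lee_fin.
    exact/measurable_EFinP.
  exact/measurable_EFinP.
have m0' j w : 0 <= m j w by exact: ltW.
have mh2 : measurable_fun setT (fun x => h x ^+ 2) by exact: measurable_funX.
have mVh j : measurable_fun setT (fun w => V j w * h (xi j w) ^+ 2).
  apply: measurable_funM => //; apply: measurable_funX.
  exact: measurableT_comp.
(* [m + s^2 / m] is affine in [s^2] as long as the maximum [m] is not updated;
   an update turns it into [2 s], which is below [m + s^2 / m] by AM-GM. *)
have key : (\int[PW]_w (m n w + V n w)%:E <= 2%:E)%E.
  elim: n => [|j IH].
    (* The empty product is 1, so both summands equal 1 at time 0: this is the constant 2. *)
    under eq_integral => w _.
      rewrite /V /m/= /s big_ord0 expr1n divr1; over.
    by rewrite integral_cst//= [X in (_ * X)%E](probability_setT PW) mule1.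
  apply: le_trans IH.
  apply: (@le_trans _ _ (\int[PW]_w (m j w + V j w * h (xi j w) ^+ 2)%:E)%E).
    apply: ge0_le_integral => //.
    - by move=> w _; rewrite lee_fin addr_ge0.
    - by apply/measurable_EFinP; exact: measurable_funD.
    - by apply/measurable_EFinP; exact: measurable_funD.
    move=> w _; rewrite lee_fin.
    have -> : V j w * h (xi j w) ^+ 2 = s j.+1 w ^+ 2 / m j w.
      by rewrite /V /s big_ord_recr/= exprMn mulrAC.
    rewrite /V /m /= -/(m j w); have := m0 j w; move: (m j w) (s0 j.+1 w) => a.
    set b := s j.+1 w => b0 a0.
    rewrite /Num.max; case: ltP => // ab.
    have b0' : 0 < b by exact: lt_trans ab.
    rewrite expr2 mulfK ?gt_eqF// -subr_ge0.
    have -> : a + b * b / a - (b + b) = (a - b) ^+ 2 / a by field; rewrite gt_eqF.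
    by rewrite divr_ge0 ?sqr_ge0// ltW.
  rewrite !ED//; last by move=> w; rewrite mulr_ge0 ?sqr_ge0.
  apply: leeD => //.
  exact: (past_mul_le (g := fun x => h x ^+ 2) hiid (mV_past j) (V0 j) mh2
    (fun x => sqr_ge0 _) h1).
apply: le_trans key; apply: ge0_le_integral => //.
- by move=> w _; rewrite lee_fin; exact: m0'.
- exact: mmE.
- by apply/measurable_EFinP; exact: measurable_funD.
- by move=> w _; rewrite lee_fin lerDl; exact: V0.
Qed.

(** * Logarithmic estimates for the rate and on a dyadic block *)

(** The tangent bound at -1/6, raised to the sixth power, gives exp (-1) >= (5/6)^6 > 1/3. The
    purpose is ln (ln 3) > 0, hence a positive rate from n = 3 on. *)
Lemma expR1_lt3 (R : realType) : expR 1 < 3 :> R.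
Proof.
have h : (5 / 6) ^+ 6 <= expR (- 1) :> R.
  have -> : (-1 : R) = 6 * (- 6^-1) by field.
  have h6 : 5 / 6 <= expR (- 6^-1) :> R by apply: le_trans (expR_ge1Dx _); lra.
  by rewrite expRM_natl lerXn2r// nnegrE ?expR_ge0//; lra.
have h3 : 3^-1 < expR (- 1) :> R by apply: lt_le_trans h; lra.
by rewrite -[ltLHS]invrK -expRN -[ltRHS]invrK ltf_pV2 ?posrE ?expR_gt0// invr_gt0.
Qed.

Lemma ln3_gt1 (R : realType) : 1 < ln 3 :> R.
Proof. by rewrite -ltr_expR lnK ?posrE// expR1_lt3. Qed.

Lemma ln2_gt0 (R : realType) : 0 < ln 2 :> R.
Proof. by rewrite ln_gt0// ltr1n. Qed.

Lemma ln_natSS_gt0 (R : realType) (m : nat) : 0 < ln m.+2%:R :> R.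
Proof. by rewrite ln_gt0// ltr1n. Qed.

Lemma ln_natSS_le_expn (R : realType) (m : nat) :
  ln m.+2%:R <= (2 ^ m)%:R :> R.
Proof.
apply: (@le_trans _ _ m.+1%:R); last by rewrite ler_nat ltn_expl.
rewrite -[in leLHS]addn1 natrD addrC; apply: le_ln1Dx.
by apply: lt_le_trans (ler0n _ _); rewrite ltrN10.
Qed.

(** From m ln 2 <= ln n and ln n > 1 follows m + 2 <= K ln n with K = 2 + 1 / ln 2. The additive ln
    K is absorbed into a multiple of ln (ln n), which is at least ln (ln 3) > 0. *)
Lemma lil_rate_inv_le (R : realType) : exists2 c : R, 0 < c &
  forall n m, (2 ^ m <= n)%N ->
    (@lil_rate R n)^-1 <= c * (n%:R / ln m.+2%:R).
Proof.
set K : R := 2 + (ln 2)^-1.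
have K2 : 2 < K by rewrite ltrDl invr_gt0 ln2_gt0.
have l3 : 0 < ln (ln 3) :> R by rewrite ln_gt0// ln3_gt1.
have K0 : 1 <= K by lra.
have K1 : 0 <= ln K / ln (ln 3).
  by apply: divr_ge0; [exact: ln_ge0|exact: ltW].
exists (1 + ln K / ln (ln 3)); first by lra.
move=> n m mn; have L0 := ln_natSS_gt0 R m.
have n0 : 0 < n%:R :> R by rewrite ltr0n; apply: leq_trans mn; rewrite expn_gt0.
(* For n < 3 the rate is 1, and ln (m+2) <= 2^m <= n is enough. *)
rewrite /lil_rate; case: ifPn => n3; last first.
  rewrite invr1; have : 1 <= n%:R / ln m.+2%:R :> R.
    rewrite ler_pdivlMr// mul1r; apply: le_trans (ln_natSS_le_expn R m) _.
    by rewrite ler_nat.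
  by move=> h; rewrite -[leLHS]mulr1 ler_pM//; lra.
set x : R := ln n%:R.
have x3 : ln 3 <= x by rewrite ler_ln ?posrE// ler_nat.
have x1 : 1 < x by exact: lt_le_trans (ln3_gt1 R) x3.
have x0 : 0 < x by lra.
have lx : ln (ln 3) <= ln x by rewrite ler_ln ?posrE//; have := ln3_gt1 R; lra.
have mx : m%:R * ln 2 <= x.
  rewrite mulr_natl -lnXn//  ler_ln ?posrE ?exprn_gt0//.
  by rewrite -natrX ler_nat.
have mK : m.+2%:R <= x * K.
  rewrite -addn2 natrD addrC /K mulrDr lerD//; first by lra.
  by rewrite ler_pdivlMr ?ln2_gt0.
have Lle : ln m.+2%:R <= (1 + ln K / ln (ln 3)) * ln x.
  apply: (@le_trans _ _ (ln (x * K))).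
    by rewrite ler_ln ?posrE ?mulr_gt0//; lra.
  rewrite lnM ?posrE//; last by lra.
  rewrite mulrDl mul1r lerD2l mulrAC ler_pdivlMr//.
  by rewrite ler_wpM2l// ln_ge0//; lra.
have lx0 : 0 < ln x by exact: lt_le_trans lx.
rewrite invfM invrK mulrCA ler_pM2l// ler_pdivlMr// mulrC ler_pdivrMr//.
Qed.

(* Either [ln w <= 4 L], or [w >= exp (4 L) = (m + 2)^4] and then
   [(ln w)^2 <= 16 sqrt w <= 16 w / (m + 2)^2]. *)
Lemma sqr_ln_ratio_le (R : realType) (m : nat) (w : R) : 1 <= w ->
  (ln w / ln m.+2%:R) ^+ 2 <= 16 + 16 / ln 2 ^+ 2 * (w / m.+2%:R ^+ 2).
Proof.
move=> w1; set L := ln m.+2%:R.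
have L0 : 0 < L by exact: ln_natSS_gt0.
have w0 : 0 < w by lra.
have l0 : 0 <= ln w by rewrite ln_ge0.
have M0 : 0 < m.+2%:R :> R by rewrite ltr0n.
have l2 := ln2_gt0 R.
have [h|h] := leP (ln w) (4 * L).
  apply: (@le_trans _ _ 16).
    have -> : 16 = 4 ^+ 2 :> R by rewrite -natrX.
    by rewrite lerXn2r ?nnegrE ?divr_ge0 ?(ltW L0)// ler_pdivrMr.
  by rewrite lerDl mulr_ge0// ?divr_ge0 ?sqr_ge0// ltW.
apply: (@le_trans _ _ (16 / ln 2 ^+ 2 * (w / m.+2%:R ^+ 2))); last by rewrite lerDr.
set q := expR (ln w / 4).
have q0 : 0 < q by exact: expR_gt0.
have wq : w = q ^+ 4 by rewrite -expRM_natl mulrC divfK// lnK.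
have lq : ln w <= 4 * q.
  have := expR_ge1Dx (ln w / 4); rewrite -/q; lra.
have Mq : m.+2%:R <= q.
  rewrite -[leLHS](@lnK R) ?posrE// ler_expR -/L; lra.
have lnw2 : ln w ^+ 2 <= 16 * (w / m.+2%:R ^+ 2).
  apply: (@le_trans _ _ ((4 * q) ^+ 2)).
    by rewrite lerXn2r ?nnegrE ?mulr_ge0// ltW.
  have -> : (4 * q) ^+ 2 = 16 * q ^+ 2 by ring.
  rewrite ler_pM2l// ler_pdivlMr ?exprn_gt0// wq.
  rewrite -[4%N]/(2 + 2)%N exprD ler_pM2l ?exprn_gt0//.
  by rewrite lerXn2r ?nnegrE//; exact: ltW.
have L2 : ln 2 ^+ 2 <= L ^+ 2.
  by rewrite lerXn2r ?nnegrE ?(ltW l2) ?(ltW L0)// ler_ln ?posrE// ler_nat.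
rewrite expr_div_n [leRHS]mulrAC ler_pM ?sqr_ge0 ?invr_ge0 ?sqr_ge0//.
by rewrite lef_pV2 ?posrE ?exprn_gt0.
Qed.

(** Square the hypothesis with (x + y)^2 <= 2 x^2 + 2 y^2 and divide by lam^2. With lam^2 of order
    ln (m+2) / 2^m, the drift term becomes a constant and the other one a multiple of (ln w / ln
    (m+2))^2. *)
Lemma sqr_sum_block_le (R : realType) (sigma delta : R) (m n : nat) (s w lam : R) :
  0 < sigma -> 0 < delta -> (2 ^ m <= n < 2 ^ m.+1)%N -> 1 <= w -> 0 < lam ->
  lam ^+ 2 = delta * ln m.+2%:R / (2 ^ m)%:R ->
  lam * `|s| <= 2 * ln w + n%:R * (sigma / 2) * lam ^+ 2 ->
  s ^+ 2 / (n%:R * ln m.+2%:R) <=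
    sigma ^+ 2 * delta +
    8 / delta * (16 + 16 / ln 2 ^+ 2 * (w / m.+2%:R ^+ 2)).
Proof.
move=> sg0 d0 /andP[mn nm] w1 lam0 lamE hs.
set L := ln m.+2%:R in lamE *.
have L0 : 0 < L by exact: ln_natSS_gt0.
set N : R := (2 ^ m)%:R in lamE.
have N0 : 0 < N by rewrite ltr0n expn_gt0.
have Nn : N <= n%:R by rewrite ler_nat.
have nN : n%:R <= 2 * N by rewrite -natrM -expnS ler_nat ltnW.
have n0 : 0 < n%:R :> R by lra.
have l0 : 0 <= ln w by rewrite ln_ge0.
have hL := sqr_ln_ratio_le m w1; rewrite -/L in hL.
apply: (@le_trans _ _ (sigma ^+ 2 * delta + 8 / delta * (ln w / L) ^+ 2)); last first.
  by rewrite lerD2l ler_pM2l ?divr_gt0.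
have lam2 : 0 < lam ^+ 2 by rewrite exprn_gt0.
set b := n%:R * (sigma / 2) * lam ^+ 2 in hs.
have b0 : 0 <= b by rewrite !mulr_ge0 ?sqr_ge0// ltW.
have s2 : lam ^+ 2 * s ^+ 2 <= 8 * ln w ^+ 2 + 2 * b ^+ 2.
  rewrite -[s ^+ 2]real_normK ?num_real// -exprMn.
  apply: (@le_trans _ _ ((2 * ln w + b) ^+ 2)).
    by rewrite lerXn2r ?nnegrE ?mulr_ge0 ?addr_ge0 ?mulr_ge0// ltW.
  have := sqr_ge0 (2 * ln w - b); rewrite !expr2; lra.
rewrite ler_pdivrMr ?mulr_gt0// -(ler_pM2l lam2); apply: le_trans s2 _.
rewrite [in leRHS]mulrDl [leRHS]mulrDr [leRHS]addrC; apply: lerD.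
  (* The logarithmic term is covered because n / N >= 1, the start of the block. *)
  have -> : lam ^+ 2 * (8 / delta * (ln w / L) ^+ 2 * (n%:R * L)) =
     8 * ln w ^+ 2 * (n%:R / N).
    by rewrite lamE; field; rewrite !gt_eqF.
  rewrite ler_peMr ?mulr_ge0 ?sqr_ge0//.
  by rewrite ler_pdivlMr// mul1r.
have -> : 2 * b ^+ 2 = lam ^+ 2 * (sigma ^+ 2 / 2 * lam ^+ 2 * n%:R * n%:R).
  by rewrite /b; field.
rewrite ler_pM2l// lamE.
(* The drift term is covered because n / (2N) <= 1, the end of the block. *)
have -> : sigma ^+ 2 / 2 * (delta * L / N) * n%:R * n%:R =
  (sigma ^+ 2 * delta * (n%:R * L)) * (n%:R / (2 * N)) by field; rewrite gt_eqF.
rewrite ler_piMr//; first by rewrite !mulr_ge0 ?sqr_ge0// ltW.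
by rewrite ler_pdivrMr ?mul1r// mulr_gt0.
Qed.

(** * An integral comparison and a summable series *)

(** No measurability is assumed: the integral of a nonnegative function is a supremum over the
    simple functions below it. This serves for the supremum over n in the theorem. *)
Lemma ge0_le_integral_setT (d : measure_display) (T : measurableType d)
    (R : realType) (nu : {measure set T -> \bar R}) (f g : T -> \bar R) :
  (forall x, 0 <= f x)%E -> (forall x, f x <= g x)%E ->
  (\int[nu]_x f x <= \int[nu]_x g x)%E.
Proof.
move=> f0 fg; rewrite !ge0_integralTE//; last first.
  by move=> x; exact: le_trans (f0 x) (fg x).
apply: ereal_sup_le => _ [h hf <-]; exists h => // x.
exact: le_trans (hf x) (fg x).
Qed.

(** Telescoping: 1 / (m+2)^2 <= 1 / (m+1) - 1 / (m+2). *)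
Lemma nneseries_inv_sqr_le1 (R : realType) :
  (\sum_(0 <= m <oo) ((m.+2%:R ^+ 2)^-1 : R)%:E <= 1%:E)%E.
Proof.
apply: lime_le.
  by apply: is_cvg_nneseries => m _ _; rewrite lee_fin invr_ge0 exprn_ge0.
near=> N; rewrite sumEFin lee_fin.
suff : \sum_(0 <= m < N) (m.+2%:R ^+ 2)^-1 <= 1 - N.+1%:R^-1 :> R.
  by move/le_trans; apply; rewrite gerBl.
elim: (N) => [|n IH]; first by rewrite big_geq// invr1 subrr.
rewrite big_nat_recr//=; apply: le_trans (lerD IH (lexx _)) _.
have n1 : 0 < n.+1%:R :> R by rewrite ltr0n.
have -> : n.+2%:R = n.+1%:R + 1 :> R by rewrite natr1.
move: n1; set t := n.+1%:R => t0.
rewrite -subr_ge0.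
have -> : 1 - (t + 1)^-1 - (1 - t^-1 + ((t + 1) ^+ 2)^-1) =
    (t * (t + 1) ^+ 2)^-1 by field; rewrite !gt_eqF//; lra.
by rewrite invr_ge0 mulr_ge0 ?sqr_ge0// ltW.
Unshelve. all: by end_near. Qed.

(** * Euclidean norm and exponential tilts *)

Lemma dotv_ge0 (R : realType) (k : nat) (u : 'rV[R]_k) : 0 <= dotv u u.
Proof. by apply: sumr_ge0 => i _; rewrite -expr2 sqr_ge0. Qed.

Lemma sqr_enorm (R : realType) (k : nat) (u : 'rV[R]_k) : enorm u ^+ 2 = dotv u u.
Proof. by rewrite /enorm sqr_sqrtr// dotv_ge0. Qed.

Lemma dotv_sumr (R : realType) (k n : nat) (u : 'rV[R]_k) (v : 'I_n -> 'rV[R]_k) :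
  dotv u (\sum_(j < n) v j) = \sum_(j < n) dotv u (v j).
Proof.
rewrite /dotv exchange_big/=; apply: eq_bigr => i _.
by rewrite summxE mulr_sumr.
Qed.

Lemma dotv_delta (R : realType) (k : nat) (a : R) (i : 'I_k) (v : 'rV[R]_k) :
  dotv (a *: delta_mx 0 i) v = a * v 0 i.
Proof.
rewrite /dotv (bigD1 i)//= big1 ?addr0; first by rewrite !mxE !eqxx mulr1.
by move=> j ji; rewrite !mxE eqxx (negbTE ji)/= mulr0 mul0r.
Qed.

(* Square root of the exponential supermartingale factor
   exp (eta . (phi x - mu) - sigma |eta|^2 / 2). *)
Definition sqrt_tilt (T : Type) (R : realType) (k : nat) (phi : T -> 'rV[R]_k)
    (sigma : R) (mu eta : 'rV[R]_k) (x : T) : R :=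
  expR (2^-1 * (dotv eta (phi x - mu) - sigma * dotv eta eta / 2)).

Lemma prod_sqrt_tilt (T : Type) (R : realType) (k n : nat) (phi : T -> 'rV[R]_k)
    (sigma : R) (mu eta : 'rV[R]_k) (x : 'I_n -> T) :
  \prod_(j < n) sqrt_tilt phi sigma mu eta (x j) =
  expR (2^-1 * (dotv eta (\sum_(j < n) (phi (x j) - mu)) -
    n%:R * (sigma * dotv eta eta / 2))).
Proof.
rewrite /sqrt_tilt -expR_sum -mulr_sumr big_split/= -dotv_sumr.
by rewrite sumr_const card_ord mulNrn mulr_natl.
Qed.

Lemma measurable_sqrt_tilt (d : measure_display) (T : measurableType d)
    (R : realType) (k : nat) (phi : T -> 'rV[R]_k) (sigma : R)
    (mu eta : 'rV[R]_k) :
  (forall i, measurable_fun setT (fun x => phi x 0 i)) ->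
  measurable_fun setT (sqrt_tilt phi sigma mu eta).
Proof.
move=> mphi; apply: measurableT_comp; first exact: measurable_expR.
apply: measurable_funM; first exact: measurable_cst.
apply: measurable_funB; last exact: measurable_cst.
apply: measurable_sum => i; apply: measurable_funM; first exact: measurable_cst.
under eq_fun do rewrite !mxE.
by apply: measurable_funB => //; exact: measurable_cst.
Qed.

Lemma integral_sqr_sqrt_tilt_le1 (d : measure_display) (T : measurableType d)
    (R : realType) (k : nat) (P : probability T R) (phi : T -> 'rV[R]_k)
    (sigma : R) (mu eta : 'rV[R]_k) :
  (forall i, measurable_fun setT (fun x => phi x 0 i)) ->
  (\int[P]_x (expR (dotv eta (phi x - mu)))%:E
     <= (expR (sigma * dotv eta eta / 2))%:E)%E ->
  (\int[P]_x (sqrt_tilt phi sigma mu eta x ^+ 2)%:E <= 1)%E.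
Proof.
move=> mphi mgf.
set c := sigma * dotv eta eta / 2 in mgf *.
have E x : (sqrt_tilt phi sigma mu eta x ^+ 2)%:E =
    ((expR (- c))%:E * (expR (dotv eta (phi x - mu)))%:E)%E.
  rewrite -EFinM -expRD /sqrt_tilt -/c -expRM_natl mulrA mulfV// mul1r.
  by rewrite addrC.
under eq_integral do rewrite E.
rewrite ge0_integralZl ?lee_fin ?expR_ge0//; last first.
  apply/measurable_EFinP; apply: measurableT_comp; first exact: measurable_expR.
  apply: measurable_sum => i; apply: measurable_funM; first exact: measurable_cst.
  under eq_fun do rewrite !mxE.
  by apply: measurable_funB => //; exact: measurable_cst.
apply: le_trans (lee_wpmul2l _ mgf) _; first by rewrite lee_fin expR_ge0.
by rewrite -EFinM -expRD addNr expR0.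
Qed.

(** The vectors lam e_i and -lam e_i of block m; both signs are needed to bound the absolute value
    of a coordinate sum. *)
Definition coord_tilt (R : realType) (k : nat) (delta : R) (i : 'I_k) (m : nat)
    (sgn : bool) : 'rV[R]_k :=
  ((-1) ^+ sgn * Num.sqrt (delta * ln m.+2%:R / (2 ^ m)%:R)) *: delta_mx 0 i.

(** Since ln (m+2) <= 2^m, the tilt of every block stays in the ball where the moment generating
    function is controlled. *)
Lemma dotv_coord_tilt (R : realType) (k : nat) (delta : R) (i : 'I_k) (m : nat)
    (sgn : bool) : 0 < delta ->
  let eta := coord_tilt delta i m sgn in
  dotv eta eta = delta * ln m.+2%:R / (2 ^ m)%:R /\ dotv eta eta <= delta.
Proof.
move=> d0 eta.
have L0 := ln_natSS_gt0 R m.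
have N0 : 0 < (2 ^ m)%:R :> R by rewrite ltr0n expn_gt0.
have -> : dotv eta eta = delta * ln m.+2%:R / (2 ^ m)%:R.
  rewrite /eta dotv_delta !mxE !eqxx mulr1 -expr2 exprMn -signr_odd -exprM.
  by rewrite mulnC exprM sqrrN !expr1n mul1r sqr_sqrtr// divr_ge0 ?mulr_ge0// ltW.
split=> //; rewrite -mulrA ler_piMr ?(ltW d0)//.
by rewrite ler_pdivrMr// mul1r ln_natSS_le_expn.
Qed.

(** * The bound for a single coordinate *)

(** The majorant [B] is a + b times the sum over all blocks of the two running maxima divided by
    (m+2)^2. [C] is chosen before the law and the probability space, which gives uniformity over
    [M]. *)
Lemma coord_sup_bound (R : realType) (k : nat) (sigma delta : R) :
  0 < sigma -> 0 < delta -> exists2 C : R, 0 <= C &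
  forall (d d' : measure_display) (X : measurableType d) (W : measurableType d')
    (phi : X -> 'rV[R]_k) (mu : 'rV[R]_k) (P : probability X R)
    (PW : probability W R) (xi : nat -> W -> X) (i : 'I_k),
  (forall j, measurable_fun setT (fun x => phi x 0 j)) ->
  (forall eta : 'rV[R]_k, enorm eta ^+ 2 <= delta ->
     (\int[P]_x (expR (dotv eta (phi x - mu)))%:E
        <= (expR (sigma * dotv eta eta / 2))%:E)%E) ->
  iid PW xi P ->
  exists B : W -> \bar R,
    [/\ measurable_fun setT B, (forall w, 0 <= B w)%E,
        (\int[PW]_w B w <= C%:E)%E &
        forall w n, (0 < n)%N ->
          (((mu - n%:R^-1 *: \sum_(j < n) phi (xi j w)) 0 i) ^+ 2
             / lil_rate n)%:E <= B w]%E.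
Proof.
move=> sg0 d0; have [c c0 hc] := lil_rate_inv_le R.
(* [a] and [b] collect the constant and the coefficient of w / (m+2)^2 in [sqr_sum_block_le], times
   the factor [c] from the rate. *)
pose a := c * (sigma ^+ 2 * delta + 8 / delta * 16).
pose b := c * (8 / delta * (16 / ln 2 ^+ 2)).
have d8 : 0 <= 8 / delta by rewrite divr_ge0// ltW.
have a0 : 0 <= a.
  by rewrite /a !(mulr_ge0, addr_ge0) ?sqr_ge0 ?invr_ge0// ltW.
have b0 : 0 <= b.
  by rewrite /b !mulr_ge0 ?invr_ge0 ?sqr_ge0// ltW.
(* The 4 comes from two running maxima of expectation at most 2, and the weights 1 / (m+2)^2 sum to
   at most 1. *)
exists (a + b * 4); first by rewrite addr_ge0// mulr_ge0.
move=> d d' X W phi mu P PW xi i mphi mgf hiid.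
have [mxi _ _] := hiid.
pose h m sgn := sqrt_tilt phi sigma mu (coord_tilt delta i m sgn).
have h0 m sgn x : 0 <= h m sgn x by exact: expR_ge0.
have mh m sgn : measurable_fun setT (h m sgn) by exact: measurable_sqrt_tilt.
have h1 m sgn : (\int[P]_x (h m sgn x ^+ 2)%:E <= 1)%E.
  apply: integral_sqr_sqrt_tilt_le1 => //; apply: mgf.
  by rewrite sqr_enorm; have [] := dotv_coord_tilt i m sgn d0.
pose s m sgn j w := \prod_(l < j) h m sgn (xi l w).
(* The maximum runs from time 0, where the product is 1, past the end of block m. *)
pose A m sgn w := run_max (s m sgn ^~ w) (2 ^ m.+1).
have A1 m sgn w : 1 <= A m sgn w.
  have := run_max_ge (s m sgn ^~ w) (leq0n (2 ^ m.+1)).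
  by rewrite /s big_ord0.
have mA m sgn : measurable_fun setT (A m sgn).
  apply: measurable_run_max => j _.
  have -> : s m sgn j = fun w => \prod_(l <- iota 0 j) h m sgn (xi l w).
    apply/funext => w.
    by rewrite /s -[in RHS](subn0 j) -/(index_iota 0 j) big_mkord.
  apply: (@measurable_prod _ W R setT _ (iota 0 j)
    (fun l w => h m sgn (xi l w))) => l _.
  exact: measurableT_comp.
have EA m sgn : (\int[PW]_w (A m sgn w)%:E <= 2%:E)%E.
  exact: expectation_run_max_le hiid (mh m sgn) (h0 m sgn) (h1 m sgn).
pose V m w := (A m false w + A m true w) / m.+2%:R ^+ 2.
have A0 m sgn w : 0 <= A m sgn w by exact: le_trans (A1 m sgn w).
have V0 m w : (0 <= (V m w)%:E)%E.
  by rewrite lee_fin divr_ge0 ?addr_ge0// exprn_ge0.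
have mV m : measurable_fun setT (fun w => (V m w)%:E).
  apply/measurable_EFinP; apply: measurable_funM; last exact: measurable_cst.
  exact: measurable_funD.
have EV m : (\int[PW]_w (V m w)%:E <= 4%:E * ((m.+2%:R ^+ 2)^-1)%:E)%E.
  under eq_integral => w _ do rewrite /V mulrC EFinM EFinD.
  rewrite ge0_integralZl//=.
  - rewrite ge0_integralD//; last 4 first.
    + by move=> w _; rewrite lee_fin.
    + exact/measurable_EFinP.
    + by move=> w _; rewrite lee_fin.
    + exact/measurable_EFinP.
    rewrite muleC; apply: lee_wpmul2r; first by rewrite lee_fin invr_ge0 exprn_ge0.
    have -> : 4%:E = (2%:E + 2%:E)%E :> \bar R by rewrite -EFinD -natrD.
    by apply: leeD; exact: EA.
  - by apply: emeasurable_funD; exact/measurable_EFinP.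
  - by move=> w _; rewrite adde_ge0 ?lee_fin.
pose S w := (\sum_(0 <= m <oo) (V m w)%:E)%E.
have S0 w : (0 <= S w)%E by exact: nneseries_ge0.
have mS : measurable_fun setT S by exact: ge0_emeasurable_sum.
have ES : (\int[PW]_w S w <= 4%:E)%E.
  rewrite /S integral_nneseries//.
  apply: (@le_trans _ _ (\sum_(0 <= m <oo) (4%:E * ((m.+2%:R ^+ 2)^-1)%:E))%E).
    by apply: lee_nneseries => [m _ _|m _]; [exact: integral_ge0|exact: EV].
  rewrite nneseriesZl; last by move=> m _; rewrite lee_fin invr_ge0 exprn_ge0.
  rewrite -[leRHS]mule1; apply: lee_wpmul2l; first by rewrite lee_fin.
  exact: nneseries_inv_sqr_le1.
exists (fun w => a%:E + b%:E * S w)%E; split.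
- apply: emeasurable_funD; first exact: measurable_cst.
  by apply: measurable_funeM.
- by move=> w; rewrite adde_ge0 ?mule_ge0// lee_fin.
- rewrite ge0_integralD//; last 2 first.
  + by move=> w _; rewrite mule_ge0.
  + exact: measurable_funeM.
  rewrite integral_cst// [X in (_ * X)%E](probability_setT PW) mule1.
  rewrite ge0_integralZl ?lee_fin// EFinD [(b * 4)%:E]EFinM.
  by apply: leeD => //; apply: lee_wpmul2l; rewrite ?lee_fin.
- move=> w n n0; set m := trunc_log 2 n.
  have mn : (2 ^ m <= n < 2 ^ m.+1)%N by exact: trunc_log_bounds.
  have n0' : 0 < n%:R :> R by rewrite ltr0n.
  pose s_n : R := \sum_(j < n) (phi (xi j w) 0 i - mu 0 i).
  have -> : (mu - n%:R^-1 *: \sum_(j < n) phi (xi j w)) 0 i = - (s_n / n%:R).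
    rewrite !mxE summxE /s_n sumrB sumr_const card_ord -mulr_natl.
    by field; rewrite gt_eqF.
  rewrite sqrrN expr_div_n.
  pose om := A m false w + A m true w.
  have om1 : 1 <= om by rewrite /om; have := A1 m false w; have := A0 m true w; lra.
  pose lam := Num.sqrt (delta * ln m.+2%:R / (2 ^ m)%:R).
  have L0 := ln_natSS_gt0 R m.
  have lam0 : 0 < lam by rewrite sqrtr_gt0 divr_gt0 ?mulr_gt0// ltr0n expn_gt0.
  have lamE : lam ^+ 2 = delta * ln m.+2%:R / (2 ^ m)%:R.
    by rewrite sqr_sqrtr// divr_ge0 ?mulr_ge0// ltW.
  (* Take logarithms in s_n <= om; the factor 2 undoes the square root in [sqrt_tilt]. *)
  have hs (sgn : bool) : lam * ((-1) ^+ sgn * s_n) <=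
      2 * ln om + n%:R * (sigma / 2) * lam ^+ 2.
    have sA : s m sgn n w <= om.
      apply: (@le_trans _ _ (A m sgn w)).
        by apply: run_max_ge; case/andP: mn => _ /ltnW.
      by rewrite /om; case: sgn; rewrite (lerDl, lerDr).
    have : ln (s m sgn n w) <= ln om.
      by rewrite ler_ln ?posrE//; [apply: prodr_gt0 => l _; exact: expR_gt0|lra].
    rewrite /s /h prod_sqrt_tilt expRK dotv_delta summxE.
    have [-> _] := dotv_coord_tilt i m sgn d0; rewrite -/lam -lamE.
    under eq_bigr do rewrite !mxE.
    rewrite -/s_n; move: ((-1) ^+ sgn) => e; lra.
  have hs' : lam * `|s_n| <= 2 * ln om + n%:R * (sigma / 2) * lam ^+ 2.
    (* The tilt is chosen by the sign of the sum. *)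
    have := hs (s_n < 0); have [s0|s0] := ltP s_n 0.
      by rewrite ltr0_norm// expr1 mulN1r.
    by rewrite ger0_norm// expr0 mul1r.
  have main := sqr_sum_block_le sg0 d0 mn om1 lam0 lamE hs'.
  have Vle : ((V m w)%:E <= S w)%E.
    (* A term of a nonnegative series is at most its sum, so one [S] serves all blocks. *)
    rewrite /S (@nneseriesD1 _ _ m)//.
    by rewrite leeDl// nneseries_ge0.
  apply: (@le_trans _ _ (a + b * V m w)%:E); last first.
    rewrite EFinD [(b * _)%:E]EFinM; apply: leeD2l.
    by apply: lee_wpmul2l; rewrite ?lee_fin.
  rewrite lee_fin.
  have mn1 : (2 ^ m <= n)%N by case/andP: mn.
  apply: (@le_trans _ _ (s_n ^+ 2 / n%:R ^+ 2 * (c * (n%:R / ln m.+2%:R)))).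
    by apply: ler_wpM2l; [rewrite divr_ge0 ?sqr_ge0|exact: hc].
  have -> : s_n ^+ 2 / n%:R ^+ 2 * (c * (n%:R / ln m.+2%:R)) =
      c * (s_n ^+ 2 / (n%:R * ln m.+2%:R)) by field; rewrite !gt_eqF.
  have -> : a + b * V m w = c * (sigma ^+ 2 * delta +
      8 / delta * (16 + 16 / ln 2 ^+ 2 * (om / m.+2%:R ^+ 2))).
    by rewrite /a /b /V -/om; ring.
  by rewrite ler_pM2l.
Qed.

(** * Summation over the coordinates *)

Unset Implicit Arguments.
Set Strict Implicit.

Theorem theorem5p3 (R : realType) (k : nat) (d : measure_display)
  (X : measurableType d) (nu : {measure set X -> \bar R})
  (r : X -> R) (phi : X -> 'rV[R]_k) (psi : 'rV[R]_k -> R)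
  (Theta Mbar : set 'rV[R]_k) (Q P : 'rV[R]_k -> probability X R)
  (p : 'rV[R]_k -> X -> \bar R)
  (hfam : mean_value_exponential_family nu r phi psi Theta Mbar Q P p)
  (mle : forall n, ('I_n -> X) -> 'rV[R]_k)
  (hmle : forall n (x : 'I_n -> X), (0 < n)%N ->
     is_unique_mle Mbar p x (mle n x) /\
     mle n x = n%:R^-1 *: \sum_(i < n) phi (x i))
  (M : set 'rV[R]_k) (hM : M `<=` Mbar)
  (sigma delta : R) (hsigma : 0 < sigma) (hdelta : 0 < delta)
  (hmgf : forall mu eta : 'rV[R]_k, M mu -> enorm eta ^+ 2 <= delta ->
     (\int[P mu]_x ((expR (dotv eta (phi x - mu)))%:E)
        <= (expR (sigma * dotv eta eta / 2))%:E)%E) :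
  exists2 C : R, 0 < C & (ereal_sup (sup_risks P mle M) <= C%:E)%E.
Proof.
have mphi := nef_stat_measurable (mvef_natural hfam).
have [C C0 hC] := coord_sup_bound k hsigma hdelta.
(* The added 1 keeps the constant positive even if k or [C] is 0. *)
exists (k%:R * C + 1); first by rewrite ltr_wpDl// mulr_ge0.
apply: ge_ereal_sup => _ [mu Mmu [d' [W [PW [xi [hiid ->]]]]]].
have /choice[B hB] := fun i => hC _ _ X W phi mu (P mu) PW xi i mphi
  (fun eta => hmgf mu eta Mmu) hiid.
have rate_ge0 n : 0 <= @lil_rate R n.
  rewrite /lil_rate; case: ifPn => // n3; rewrite mulr_ge0 ?invr_ge0// ln_ge0//.
  apply: ltW; apply: lt_le_trans (ln3_gt1 R) _.
  by rewrite ler_ln ?posrE ?ltr0n ?ler_nat//; exact: leq_trans n3.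
apply: (@le_trans _ _ (\int[PW]_w \sum_(i < k) B i w)%E).
  apply: ge0_le_integral_setT => w.
    apply: le_ereal_sup_tmp; eexists; first by exists 1%N.
    by rewrite lee_fin mulr_ge0 ?sqr_ge0// invr_ge0.
  apply: ge_ereal_sup => _ [n /= n0 <-].
  have [_ ->] := hmle n (fun i : 'I_n => xi i w) n0.
  (* The squared Euclidean norm splits into coordinates, each below its own majorant [B i] for every
     n. *)
  rewrite sqr_enorm /dotv mulr_suml -sumEFin.
  by apply: lee_sum => i _; rewrite -expr2; have [_ _ _] := hB i; apply.
rewrite ge0_integral_sum//; last 2 first.
- by move=> i; have [] := hB i.
- by move=> i w _; have [] := hB i.
apply: (@le_trans _ _ (\sum_(i < k) C%:E)%E).
  by apply: lee_sum => i _; have [] := hB i.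
by rewrite sumEFin lee_fin sumr_const card_ord -[C *+ k]mulr_natl lerDl.
Qed.
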